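(* Let $A=\{0,1\}$ and let $\mathcal P_0,\mathcal P_1$ be closed. Suppose $v(\omega,1)-v(\omega,0)=v>0$ for all $\omega\in\Omega$ (with $v$ a constant independent of $\omega$). Assume that the set $\mathcal P_1^c=\{\mu\in\Delta(\Omega):\hat\rho(\mu)<0\}$ is convex, and that the following monotonicity condition holds: there exists a strict total order $\prec$ on $\Omega$ such that if $\omega\prec\omega'$, then either (1) $\omega\in K_1$, or (2) $\omega,\omega'\in L_0$ and $\gamma(\omega,\hat\omega)>\gamma(\omega',\hat\omega)$ for all $\hat\omega\in K_1$. Then the optimal signaling scheme induces a threshold structure in the receiver's actions: there exists an $\omega_0\in L_0$ such that $$t_1(\omega)=\begin{cases}\mu^*(\omega)&\text{if }\omega\prec\omega_0,\\ 0&\text{if }\omega_0\prec\omega.\end{cases}$$ In particular, under the optimal signaling scheme, the receiver chooses action $1$ in states $\omega\prec\omega_0$, and chooses action $0$ in states $\omega$ with $\omega_0\prec\omega$.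
   Context: $\Omega$ is a finite set of states, $\Delta(\Omega)\subset\mathbb R^{|\Omega|}$ the set of probability vectors on $\Omega$, $\mu^*\in\Delta(\Omega)$ the common prior. The receiver's utility is a function $\rho:\Delta(\Omega)\times\{0,1\}\to\mathbb R$ of belief and action, the sender's utility is $v:\Omega\times\{0,1\}\to\mathbb R$, and $\hat\rho(\mu)=\rho(\mu,1)-\rho(\mu,0)$. Put $\mathcal P_1=\{\mu\in\Delta(\Omega):\hat\rho(\mu)\ge0\}$ and $\mathcal P_0=\{\mu\in\Delta(\Omega):\hat\rho(\mu)\le0\}$ (the beliefs at which action $1$, respectively $0$, is optimal for the receiver); complements are taken in $\Delta(\Omega)$. A state $\omega$ is identified with the point mass $e_\omega\in\Delta(\Omega)$. Define $K_1=\mathcal P_1\cap\Omega$, $K_0=\mathcal P_0\cap\Omega$, $L_0=K_0\cap K_1^c$ and, for $\omega_0\in L_0$, $\omega_1\in K_1$, $\gamma(\omega_0,\omega_1)=\sup\{\gamma\in[0,1]:\gamma\omega_0+(1-\gamma)\omega_1\in\mathcal P_1\}$. A signaling scheme $(S,\pi)$ consists of a signal space $S$ and a joint distribution $\pi$ of the state $\bar\omega$ and signal $\bar s$ on $\Omega\times S$ with $\Omega$-marginal $\mu^*$; $\mu_s$ is the receiver's posterior belief about $\bar\omega$ given $\bar s=s$. A receiver strategy $a:S\to\{0,1\}$ is optimal if $a(s)\in\arg\max_a\rho(\mu_s,a)$ for each $s$. The sender chooses a signaling scheme maximizing $\mathbf E_\pi[v(\bar\omega,a(\bar s))]$, the receiver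 responding with an optimal strategy (the sender's most preferred one if there are several); a scheme attaining this maximum is optimal. For the optimal signaling scheme, $t_1(\omega)$ denotes the joint probability that the realized state is $\omega$ and the receiver takes action $1$.
   Formalization: The set L_0 is assumed nonempty; when every state lies in K_1 (for example when the receiver always strictly prefers action 1), all hypotheses can hold but no ω_0 in L_0 exists, so the claim as stated fails. *)

(* Defs.v *)
From HB Require Import structures.
From mathcomp Require Import all_boot all_order all_algebra.
From mathcomp Require Import all_classical all_reals all_analysis.

Set Implicit Arguments.
Unset Strict Implicit.
Unset Printing Implicit Defensive.

Import Order.TTheory GRing.Theory Num.Theory.
Import numFieldNormedType.Exports.

Local Open Scope classical_set_scope.
Local Open Scope ring_scope.

(* The sigma-algebra makes [Omega * S] a measurable type; that it is the
   discrete one has to be assumed separately. *)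
#[short(type="finMeasurableType")]
HB.structure Definition FinMeasurable d := {T of Finite T & Measurable d T}.

(* A belief is a function [Omega -> R] lying in [Delta]; a utility [rho] over
   beliefs is total on [Omega -> R], but is only ever used on [Delta].
   Actions are booleans: [true] is action 1 and [false] is action 0. *)
Section beliefs.
Context {R : realType} {Omega : finType}.
Implicit Types (mu : Omega -> R) (rho : (Omega -> R) -> bool -> R).

Definition Delta : set (Omega -> R) :=
  [set mu | (forall w, 0 <= mu w) /\ \sum_(w : Omega) mu w = 1].

Definition point_mass (w : Omega) : Omega -> R := fun w' => (w' == w)%:R.

Definition rhohat rho mu : R := rho mu true - rho mu false.

Definition P1 rho : set (Omega -> R) := [set mu | Delta mu /\ 0 <= rhohat rho mu].

Definition P0 rho : set (Omega -> R) := [set mu | Delta mu /\ rhohat rho mu <= 0].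

Definition P1c rho : set (Omega -> R) := Delta `\` P1 rho.

Definition K1 rho : set Omega := [set w | P1 rho (point_mass w)].

Definition K0 rho : set Omega := [set w | P0 rho (point_mass w)].

Definition L0 rho : set Omega := K0 rho `&` ~` K1 rho.

Definition gamma rho (w0 w1 : Omega) : R :=
  sup [set g : R | 0 <= g <= 1 /\
    P1 rho (g *: point_mass w0 + (1 - g) *: point_mass w1)].

Definition strict_total_order (prec : rel Omega) : Prop :=
  [/\ irreflexive prec, transitive prec &
      forall w w', w != w' -> prec w w' || prec w' w].

Definition monotone_order rho (prec : rel Omega) : Prop :=
  forall w w', prec w w' ->
    K1 rho w \/
    [/\ L0 rho w, L0 rho w' &
        forall w1, K1 rho w1 -> gamma rho w' w1 < gamma rho w w1].

End beliefs.

Section schemes.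
Context {R : realType} {dO : measure_display} {Omega : finMeasurableType dO}.

Definition signaling_scheme (mustar : Omega -> R) d (S : measurableType d)
    (pi : probability (Omega * S)%type R) : Prop :=
  forall w, pi ([set w] `*` [set: S]) = (mustar w)%:E.

(* [post] is a regular version of the conditional law of the state given the
   signal; it is unique up to a null set of signals. *)
Definition is_posterior d (S : measurableType d)
    (pi : probability (Omega * S)%type R) (post : S -> Omega -> R) : Prop :=
  [/\ forall s, Delta (post s),
      forall w, measurable_fun [set: S] (fun s => post s w) &
      forall w (B : set S), measurable B ->
        pi ([set w] `*` B) = (\int[pi]_(x in [set: Omega] `*` B) (post x.2 w)%:E)%E].

Definition optimal_strategy (rho : (Omega -> R) -> bool -> R)
    d (S : measurableType d) (pi : probability (Omega * S)%type R)
    (a : S -> bool) : Prop :=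
  measurable_fun [set: S] a /\
  exists2 post, is_posterior pi post &
    forall s b, rho (post s) b <= rho (post s) (a s).

Definition sender_payoff (v : Omega -> bool -> R)
    d (S : measurableType d) (pi : probability (Omega * S)%type R)
    (a : S -> bool) : \bar R :=
  'E_pi[fun x => v x.1 (a x.2)]%E.

Definition sender_preferred_strategy (rho : (Omega -> R) -> bool -> R)
    (v : Omega -> bool -> R)
    d (S : measurableType d) (pi : probability (Omega * S)%type R)
    (a : S -> bool) : Prop :=
  optimal_strategy rho pi a /\
  forall a', optimal_strategy rho pi a' ->
    (sender_payoff v pi a' <= sender_payoff v pi a)%E.

Definition optimal_scheme (mustar : Omega -> R)
    (rho : (Omega -> R) -> bool -> R) (v : Omega -> bool -> R)
    d (S : measurableType d) (pi : probability (Omega * S)%type R)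
    (a : S -> bool) : Prop :=
  [/\ signaling_scheme mustar pi,
      sender_preferred_strategy rho v pi a &
      forall d' (S' : measurableType d')
        (pi' : probability (Omega * S')%type R) (a' : S' -> bool),
        signaling_scheme mustar pi' ->
        sender_preferred_strategy rho v pi' a' ->
        (sender_payoff v pi' a' <= sender_payoff v pi a)%E].

Definition t1 d (S : measurableType d) (pi : probability (Omega * S)%type R)
    (a : S -> bool) (w : Omega) : R :=
  fine (pi [set x | x.1 = w /\ a x.2 = true]).

End schemes.

(* Main.v *)
(* Because [P1c] is convex and [P1] closed, every belief in [P1] lies in the
   cone spanned by the edge points gamma(w0, w1) w0 + (1 - gamma(w0, w1)) w1
   with w1 in K1: a functional that is nonnegative on all edge points is
   nonnegative on [P1]. Integrating posteriors, it is also nonnegative at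
   [t1], so by Farkas' lemma [t1] is a finite nonnegative combination of edge
   points. Conversely every such combination below the prior is realized by a
   scheme whose signals are pairs of states, so an optimal [t1] has maximal
   total mass among them. If a state w of L0 is not exhausted while a later w'
   is used, moving weight from an edge (w', w1) to (w, w1) increases that
   mass; and states of K1 are exhausted since revealing them is feasible. *)
From HB Require Import structures.
Require Import Defs.
From mathcomp Require Import all_boot all_order all_algebra.
From mathcomp Require Import all_classical all_reals all_analysis.
From mathcomp Require Import measurable_realfun ring lra.

Import Order.TTheory GRing.Theory Num.Theory.
Import numFieldNormedType.Exports.
Local Open Scope classical_set_scope.
Local Open Scope ring_scope.

(** * Linear functionals on a finite-dimensional space and Farkas' lemma *)

Definition dot {R : realType} {T : finType} (f x : T -> R) : R :=
  \sum_w f w * x w.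

Section dot.
Context {R : realType} {T : finType}.
Implicit Types (f x y : T -> R).

Lemma dotD f x y (a b : R) :
  dot f (fun w => a * x w + b * y w) = a * dot f x + b * dot f y.
Proof.
rewrite /dot !mulr_sumr -big_split /=; apply: eq_bigr => w _; ring.
Qed.

Lemma dotDl f x y (a b : R) :
  dot (fun w => a * x w + b * y w) f = a * dot x f + b * dot y f.
Proof.
rewrite /dot !mulr_sumr -big_split /=; apply: eq_bigr => w _; ring.
Qed.

Lemma dot_point_mass f (w : T) : dot f (point_mass w) = f w.
Proof.
rewrite /dot (bigD1 w) //= /point_mass eqxx mulr1 big1 ?addr0 //.
move=> w' /negPf ->.
by rewrite mulr0.
Qed.

(* If [f] separates [t] from the cone of the tail but is negative on the head
   [g i], projecting the problem along [g i] onto the kernel of [f] removes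
   one generator. *)
Lemma farkas (I : eqType) (s : seq I) (g : I -> T -> R) (t : T -> R) :
  uniq s ->
  (exists2 y : I -> R, forall i, 0 <= y i &
     forall w, t w = \sum_(i <- s) y i * g i w) \/
  (exists2 f : T -> R, forall i, i \in s -> 0 <= dot f (g i) & dot f t < 0).
Proof.
elim: s g t => [|i s IH] g t /=.
  move=> _; have [t0|/existsNP[w0 /eqP tw0]] := pselect (forall w, t w = 0).
    by left; exists (fun=> 0) => // w; rewrite big_nil.
  right; exists (fun w => - t w) => //.
  rewrite /dot (bigD1 w0) //= mulNr -expr2.
  have : 0 < t w0 ^+ 2 by rewrite exprn_even_gt0.
  have : \sum_(w | w != w0) - t w * t w <= 0.
    by apply: sumr_le0 => w _; rewrite mulNr -expr2 oppr_le0 sqr_ge0.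
  lra.
move=> /andP[is_ us].
have neq j : j \in s -> (j == i) = false.
  by apply: contraTF => /eqP ->; exact: is_.
have [[y y0 ty]|[f f0 ft]] := IH g t us.
  left; exists (fun j => if j == i then 0 else y j) => [j|w].
    by case: ifP.
  rewrite big_cons eqxx mul0r add0r ty !big_seq.
  by apply: eq_bigr => j js; rewrite neq.
have [fi|fi] := leP 0 (dot f (g i)).
  right; exists f => // j; rewrite in_cons => /predU1P[->//|]; exact: f0.
(* For [j] in [s] both coefficients are nonnegative. Each [h j] lies in the kernel of [f], as does
   [t - k * g i] with the [k] below. *)
pose h j w := dot f (g j) * g i w + (- dot f (g i)) * g j w.
pose k := dot f t / dot f (g i).
have k0 : 0 < k by rewrite /k nmulr_rgt0 ?invr_lt0.
have [[y y0 ty]|[u u0 ut]] := IH h (fun w => 1 * t w + (- k) * g i w) us.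
  left; exists (fun j => if j == i then k + \sum_(l <- s) y l * dot f (g l)
                         else y j * - dot f (g i)) => [j|w].
    case: ifP => _; last by rewrite mulr_ge0 // oppr_ge0 ltW.
    apply: addr_ge0; first exact: ltW.
    by rewrite big_seq sumr_ge0 // => l ls; rewrite mulr_ge0 // f0.
  rewrite big_cons eqxx.
  have -> : \sum_(j <- s)
      (if j == i then k + \sum_(l <- s) y l * dot f (g l)
       else y j * - dot f (g i)) * g j w =
      \sum_(j <- s) y j * - dot f (g i) * g j w.
    by rewrite !big_seq; apply: eq_bigr => j js; rewrite neq.
  have -> : t w = k * g i w + (1 * t w + (- k) * g i w) by ring.
  rewrite ty mulrDl -addrA; congr (_ + _).
  rewrite mulr_suml -big_split /=; apply: eq_bigr => j _.
  by rewrite /h; ring.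
(* This multiple of [f] makes the functional vanish at [g i]; up to a positive factor, its values at
   [g j] and [t] are those of [u] at their projections. *)
right; exists (fun w => 1 * u w + (- (dot u (g i) / dot f (g i))) * f w).
  move=> j; rewrite in_cons dotDl => /predU1P[->|js].
    by rewrite mulNr divfK ?lt_eqF// mul1r subrr.
  have := u0 _ js; rewrite dotD => hj.
  have -> : 1 * dot u (g j) + - (dot u (g i) / dot f (g i)) * dot f (g j) =
    (- dot f (g i))^-1 *
    (dot f (g j) * dot u (g i) + - dot f (g i) * dot u (g j)).
    by field; rewrite lt_eqF.
  by rewrite mulr_ge0 // invr_ge0 oppr_ge0 ltW.
move: ut; rewrite dotD dotDl /k.
have -> // : - (dot u (g i) / dot f (g i)) * dot f t =
  - (dot f t / dot f (g i)) * dot u (g i) by ring.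
Qed.

End dot.

(** * Edge points and the convex geometry of beliefs *)

Section geometry.
Context {R : realType} {Omega : finType}.
Implicit Types (f mu t x y : Omega -> R) (rho : (Omega -> R) -> bool -> R).

Lemma sum_dot f : \sum_w f w = dot (fun=> 1) f.
Proof. by apply: eq_bigr => w _; rewrite mul1r. Qed.

Lemma Delta_point_mass (w : Omega) : Delta (point_mass w : Omega -> R).
Proof.
split=> [w'|]; first by rewrite /point_mass ler0n.
by rewrite sum_dot dot_point_mass.
Qed.

Definition mix (g : R) (w0 w1 : Omega) : Omega -> R :=
  g *: point_mass w0 + (1 - g) *: point_mass w1.

Lemma dot_mix f g w0 w1 : dot f (mix g w0 w1) = g * f w0 + (1 - g) * f w1.
Proof. by rewrite -!(dot_point_mass f) -dotD. Qed.

Lemma Delta_mix g w0 w1 : 0 <= g <= 1 -> Delta (mix g w0 w1).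
Proof.
move=> /andP[g0 g1]; split=> [w|].
  by rewrite /mix !fctE /= addr_ge0 // mulr_ge0 ?subr_ge0 // ler0n.
by rewrite sum_dot dot_mix; ring.
Qed.

(** For closed [P1] and [w1] in [K1], this is the last belief in [P1] on the way from [w1] to [w0].
    The state [w0] may itself belong to [K1]. *)
Definition edge_point rho (w0 w1 : Omega) := mix (gamma rho w0 w1) w0 w1.

Section gamma.
Variable rho : (Omega -> R) -> bool -> R.

Let G w0 w1 := [set g : R | 0 <= g <= 1 /\ P1 rho (mix g w0 w1)].

Let G_ub w0 w1 : has_ubound (G w0 w1).
Proof. by exists 1 => g [/andP[]]. Qed.

Let G0 w0 w1 : K1 rho w1 -> G w0 w1 0.
Proof.
move=> Kw1; split; first by rewrite lexx ler01.
suff -> : mix 0 w0 w1 = point_mass w1 by [].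
by rewrite /mix scale0r add0r subr0 scale1r.
Qed.

Lemma le_gamma g w0 w1 : 0 <= g <= 1 -> P1 rho (mix g w0 w1) ->
  g <= gamma rho w0 w1.
Proof. by move=> g01 Pg; apply: ub_le_sup; [exact: G_ub|split]. Qed.

Lemma gamma_itv w0 w1 : K1 rho w1 -> 0 <= gamma rho w0 w1 <= 1.
Proof.
move=> Kw1; apply/andP; split.
  by have [g01 Pg] := G0 w0 w1 Kw1; exact: le_gamma.
by apply: ge_sup => [|g [/andP[]]//]; exists 0; exact: G0.
Qed.

Lemma Delta_edge_point w0 w1 : K1 rho w1 -> Delta (edge_point rho w0 w1).
Proof. by move=> Kw1; apply/Delta_mix/gamma_itv. Qed.

(** The weights whose mixture lies in [P1] form a closed set, the preimage of [P1] under a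
    continuous path, so it contains the supremum [gamma]. *)
Lemma P1_edge_point w0 w1 : closed (P1 rho : set {ptws Omega -> R}) ->
  K1 rho w1 -> P1 rho (edge_point rho w0 w1).
Proof.
move=> cP1 Kw1.
have mixc : continuous (fun g : R => mix g w0 w1 : {ptws Omega -> R}).
  move=> g; apply/cvg_sup => w.
  rewrite cvg_image; last by rewrite eqEsubset; split=> r // _; exists (cst r).
  have mixw : (fun g => mix g w0 w1 w) @ g --> mix g w0 w1 w.
    apply: cvgD; apply: cvgM; do ?exact: cvg_cst; first exact: cvg_id.
    by apply: cvgB; [exact: cvg_cst|exact: cvg_id].
  move=> W /mixw gW; exists (@^~ w @^-1` W) => //.
  by rewrite eqEsubset; split => [j [? + <-//]|j Wj]; exists (fun=> j).
have cG : closed [set g | P1 rho (mix g w0 w1)].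
  exact: (closed_comp (fun g _ => mixc g)).
suff : closure (G w0 w1) (gamma rho w0 w1).
  move=> /(closure_subset (_ : _ `<=` [set g | P1 rho (mix g w0 w1)])).
  by rewrite -(closure_id _).1 //; apply => g [].
by apply: closure_sup => //; exists 0; exact: G0.
Qed.

End gamma.

Section convexity.
Variable rho : (Omega -> R) -> bool -> R.
Hypothesis convP1c : convex_set (P1c rho : set (convex_lmodType (Omega -> R))).

(** The convex cone generated by [P1c], with the origin: its sums need no renormalization, which
    turns long mixtures into plain finite sums. *)
Let cone t := (t = fun=> 0) \/
  exists (r : R) mu, [/\ 0 < r, P1c rho mu & t = r *: mu].

Let cone_Z (r : R) mu : 0 <= r -> P1c rho mu -> cone (r *: mu).
Proof.
rewrite le_eqVlt => /predU1P[<- _|r0 Pmu]; last by right; exists r, mu.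
by left; rewrite scale0r.
Qed.

Let cone_D t1 t2 : cone t1 -> cone t2 -> cone (fun w => t1 w + t2 w).
Proof.
move=> [->|[r1 [mu1 [r10 Pmu1 ->]]]].
  by move=> Dt2; under eq_fun do rewrite add0r.
move=> [->|[r2 [mu2 [r20 Pmu2 ->]]]].
  by under eq_fun do rewrite addr0; apply: cone_Z => //; exact: ltW.
have r0 : 0 < r1 + r2 by rewrite addr_gt0.
have l0 : 0 <= r1 / (r1 + r2) by rewrite divr_ge0 // ltW.
have l1 : r1 / (r1 + r2) <= 1 by rewrite ler_pdivrMr // mul1r lerDl ltW.
right; exists (r1 + r2).
exists ((r1 / (r1 + r2)) *: mu1 + (1 - r1 / (r1 + r2)) *: mu2).
split=> //.
  have := convP1c mu1 mu2 (Itv01 l0 l1) (mem_set Pmu1) (mem_set Pmu2).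
  by move/set_mem.
apply/funext => w; rewrite !fctE /= /GRing.scale /=.
by field; rewrite gt_eqF.
Qed.

Let cone_sum (I : Type) (s : seq I) (P : pred I) (g : I -> Omega -> R) :
  (forall i, P i -> cone (g i)) -> cone (fun w => \sum_(i <- s | P i) g i w).
Proof.
move=> Dg; elim: s => [|i s IH].
  by left; apply/funext => w; rewrite big_nil.
case Pi : (P i); under eq_fun do rewrite big_cons Pi; last by [].
by apply: cone_D => //; exact: Dg.
Qed.

Let not_K1 w : ~ K1 rho w -> P1c rho (point_mass w).
Proof. by move=> nK; split=> //; exact: Delta_point_mass. Qed.

(* Shift [f] to [h] with [h mu = 0]; if [f] were negative at [mu], then [h]
   would be positive on all edge points. Zeros of [h] on edges ending in [K1]
   then lie beyond the edge point, hence in [P1c], and [mu] is a mixture of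
   zeros of [h] on edges, hence in [P1c] by convexity. *)
Lemma P1_dot_ge0 f mu :
  (forall w0 w1, K1 rho w1 -> 0 <= dot f (edge_point rho w0 w1)) ->
  P1 rho mu -> 0 <= dot f mu.
Proof.
move=> f0 [Dmu Pmu]; rewrite leNgt; apply/negP => fmu.
pose h w := f w - dot f mu.
have hdot x : \sum_w x w = 1 -> dot h x = dot f x - dot f mu.
  move=> x1; transitivity (dot (fun w => 1 * f w + (- dot f mu) * 1) x).
    by congr dot; apply/funext => w; rewrite /h; ring.
  by rewrite (dotDl _ f (fun=> 1)) -sum_dot x1; ring.
have hmu : dot h mu = 0 by rewrite hdot ?subrr //; case: Dmu.
have hK w0 w1 : K1 rho w1 -> 0 < dot h (edge_point rho w0 w1).
  move=> Kw1; rewrite hdot; last by case: (Delta_edge_point rho w0 w1 Kw1).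
  by have := f0 w0 w1 Kw1; lra.
have hK1 w : K1 rho w -> 0 < h w.
  by move=> Kw; have := hK w w Kw; rewrite dot_mix; lra.
have h_le0 w : h w <= 0 -> P1c rho (point_mass w).
  by move=> hw; apply: not_K1 => /hK1; rewrite ltNge hw.
have mu0 w : 0 <= mu w by case: Dmu.
pose N := \sum_(j | 0 < h j) mu j * h j.
have NE : \sum_(i | h i <= 0) mu i * - h i = N.
  move: hmu; rewrite /dot (bigID (fun w => h w <= 0)) /=.
  under eq_bigr do rewrite mulrC -[_ * _]opprK -mulrN.
  rewrite sumrN /N; under [X in _ + X]eq_bigl do rewrite -ltNge.
  under [X in _ + X]eq_bigr do rewrite mulrC.
  lra.
suff : cone mu.
  case=> [mu_0|[r [nu [r0 Pnu mu_nu]]]].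
    by case: Dmu => _; rewrite mu_0 big1 // => /esym/eqP; rewrite oner_eq0.
  have r1 : r = 1.
    case: Dmu => _; rewrite mu_nu; case: Pnu => [[_ nu1] _].
    by rewrite -mulr_sumr nu1 mulr1.
  by case: Pnu => _; apply; move: mu_nu; rewrite r1 scale1r => <-.
(* If [N = 0], then [mu] charges only states with [h <= 0], whose point masses lie in [P1c]. *)
have [N0|N0] := eqVneq N 0.
  have -> : mu = fun w => \sum_(i | h i <= 0) (mu i *: point_mass i) w.
    apply/funext => w; case: (leP (h w) 0) => hw.
      rewrite (bigD1 w) //= big1 => [|i /andP[_ /negPf iw]].
        by rewrite addr0 !fctE /point_mass eqxx [RHS]mulr1.
      by rewrite !fctE /point_mass eq_sym iw [LHS]mulr0.
    rewrite big1 => [|i hi].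
      move/eqP: N0; rewrite psumr_eq0 => [|j hj]; last first.
        by rewrite mulr_ge0 // ltW.
      move=> /allP/(_ w); rewrite mem_index_enum hw mulf_eq0 (gt_eqF hw) orbF.
      by move=> /(_ isT)/eqP.
    rewrite !fctE /point_mass; have [wi|_] := eqVneq w i; last exact: mulr0.
    by move: hi; rewrite -wi leNgt hw.
  by apply: cone_sum => i hi; apply: cone_Z; [exact: mu0|exact: h_le0].
have Ngt0 : 0 < N.
  by rewrite lt_neqAle eq_sym N0 sumr_ge0 // => j hj; rewrite mulr_ge0 // ltW.
(* A product coupling: the mass at [i] is split over the [j] in proportion to [mu j * h j], that at
   [j] over the [i] in proportion to [mu i * - h i]. Both normalizing sums are [N], and each pair
   meets at the zero of [h] on its edge. *)
have -> : mu = fun w => \sum_(i | h i <= 0) \sum_(j | 0 < h j)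
    ((mu i * mu j / N * (h j - h i)) *: mix (h j / (h j - h i)) i j) w.
  apply/funext => w.
  have E i j : h i <= 0 -> 0 < h j ->
    ((mu i * mu j / N * (h j - h i)) *: mix (h j / (h j - h i)) i j) w =
    mu i * point_mass i w * (mu j * h j) / N +
    mu j * point_mass j w * (mu i * - h i) / N.
    move=> hi hj; rewrite /mix !fctE /= /GRing.scale /=; field.
    by rewrite N0 /= gt_eqF // subr_gt0 (le_lt_trans hi).
  under eq_bigr => i hi do under eq_bigr => j hj do rewrite E //.
  under eq_bigr do rewrite big_split /= -!mulr_suml -!mulr_sumr.
  rewrite -/N big_split /= -!mulr_suml -mulr_sumr NE !mulfK //.
  rewrite -[LHS](dot_point_mass mu) /dot (bigID (fun i => h i <= 0)) /=.
  congr (_ + _); first by apply: eq_bigr => i _; rewrite /point_mass eq_sym.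
  under eq_bigl do rewrite -ltNge.
  by apply: eq_bigr => i _; rewrite /point_mass eq_sym.
apply: cone_sum => i hi; apply: cone_sum => j hj.
have hji : 0 < h j - h i by rewrite subr_gt0 (le_lt_trans hi).
have c01 : 0 <= h j / (h j - h i) <= 1.
  rewrite divr_ge0 ?(ltW hj) ?(ltW hji) //= ler_pdivrMr // mul1r.
  by rewrite lerDl oppr_ge0.
have c0 : 0 <= mu i * mu j / N * (h j - h i).
  by rewrite mulr_ge0 ?divr_ge0 ?mulr_ge0 // ltW.
apply: cone_Z => //; split; first exact: Delta_mix.
have [Kj|nKj] := pselect (K1 rho j); last first.
  case/andP: c01 => l0 l1.
  have := convP1c _ _ (Itv01 l0 l1)
    (mem_set (h_le0 i hi)) (mem_set (not_K1 _ nKj)).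
  by move=> /set_mem[].
move=> /(le_gamma rho _ _ _ c01) /= le_g.
(* On the edge [h] is affine and decreases towards [i]. Its zero has weight at most [gamma], so [h]
   cannot be positive at the edge point. *)
have := hK i j Kj; rewrite dot_mix.
have : h j / (h j - h i) * (h i - h j) + h j = 0 by field; rewrite gt_eqF.
have : (gamma rho i j - h j / (h j - h i)) * (h j - h i) >= 0.
  by apply: mulr_ge0; [rewrite subr_ge0|exact: ltW].
set k := h j / (h j - h i); nra.
Qed.

End convexity.

End geometry.

(** * Finite sums of indicators and of Dirac masses *)

Lemma expectation_simple (R : realType) d (T : measurableType d)
    (P : probability T R) (I : finType) (k : I -> R) (A : I -> set T) :
  (forall i, measurable (A i)) ->
  ('E_P[(fun x => \sum_i k i * \1_(A i) x)%R] = \sum_i (k i)%:E * P (A i))%E.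
Proof.
move=> mA; rewrite unlock.
under eq_integral do rewrite -sumEFin.
have intA i : P.-integrable [set: T] (fun x => (\1_(A i) x)%:E).
  exact: integrable_indic.
rewrite integral_sum // => [|i]; last first.
  by under eq_fun do rewrite EFinM; exact: integrableZl.
apply: eq_bigr => i _; under eq_integral do rewrite EFinM.
by rewrite integralZl // integral_indic // setIT.
Qed.

Lemma prod_discrete d1 d2 (X : measurableType d1) (Y : measurableType d2) :
  (forall A : set X, measurable A) -> (forall A : set Y, measurable A) ->
  countable [set: X * Y] -> forall A : set (X * Y), measurable A.
Proof.
move=> mX mY cXY A; apply: countable_measurable => [[x y]|].
  suff -> : [set (x, y)] = [set x] `*` [set y] by exact: measurableX.
  by apply/seteqP; split=> [_ ->|[x' y'] [/= -> ->]].
by apply: sub_countable cXY; exact/subset_card_le/subsetT.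
Qed.

HB.instance Definition _ d1 d2 (X : finMeasurableType d1)
  (Y : finMeasurableType d2) := Measurable.on (X * Y)%type.

Lemma finite_mixture (R : realType) d (T : measurableType d) (I : finType)
    (p : I -> R) (x : I -> T) :
  (forall i, 0 <= p i) -> \sum_i p i = 1 ->
  exists P : probability T R,
    (forall A, P A = (\sum_i p i * (x i \in A)%:R)%:E) /\
    (forall (D : set T) (f : T -> \bar R), measurable D -> measurable_fun D f ->
       (forall t, D t -> 0 <= f t) ->
       \int[P]_(t in D) f t = \sum_i (p i * (x i \in D)%:R)%:E * f (x i))%E.
Proof.
move=> p0 p1.
(* [msum] runs over a sequence indexed by naturals, so [I] is enumerated and the tail is filled with
   the zero measure. *)
pose m (k : nat) : {measure set T -> \bar R} :=
  if insub k is Some i then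
    mscale (NngNum (p0 (enum_val (i : 'I_#|I|)))) \d_(x (enum_val i))
  else mzero.
have PE A : msum m #|I| A = (\sum_i p i * (x i \in A)%:R)%:E.
  rewrite -sumEFin /msum [RHS](reindex _ (onW_bij _ (enum_val_bij I))) /=.
  apply: eq_bigr => i _; rewrite /m insubT //= => ik.
  rewrite (_ : Sub _ _ = i); last exact: val_inj.
  by rewrite /mscale /= diracE EFinM.
have PT : msum m #|I| [set: T] = 1%E.
  rewrite PE -[in RHS]p1; congr EFin.
  by apply: eq_bigr => i _; rewrite in_setT mulr1.
pose B := Measure_isProbability.Build _ _ _ (msum m #|I|) PT.
pose P : probability T R := HB.pack (msum m #|I|) B.
exists P; split=> [|D f mD mf f0]; first exact: PE.
rewrite ge0_integral_measure_sum //.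
rewrite [RHS](reindex _ (onW_bij _ (enum_val_bij I))) /=.
apply: eq_bigr => i _; rewrite /m insubT //= => ik.
rewrite (_ : Sub _ _ = i); last exact: val_inj.
by rewrite ge0_integral_mscale // integral_dirac // diracE muleA EFinM.
Qed.

(** * Sender payoffs, action probabilities and competing schemes *)

Section schemes.
Context {R : realType} {dO : measure_display} {Omega : finMeasurableType dO}.
Hypothesis discrete_Omega : forall A : set Omega, measurable A.
Variable mustar : Omega -> R.

Section receiver.
Context d (S : measurableType d) (pi : probability (Omega * S)%type R).
Variable a : S -> bool.
Hypothesis ma : measurable_fun [set: S] a.

Let M : set S := a @^-1` [set true].

Let mM : measurable M.
Proof. by have := ma measurableT [set true]; rewrite setTI; apply. Qed.

Lemma measurable_slice (w : Omega) (B : set S) :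
  measurable B -> measurable ([set w] `*` B).
Proof. by move=> mB; apply: (@measurableX _ _ Omega S). Qed.

Lemma t1E w : (t1 pi a w)%:E = pi ([set w] `*` M).
Proof.
rewrite /t1 fineK; first by [].
by apply: fin_num_measure; exact: (measurable_slice w M).
Qed.

(** A gain [c] common to all states makes the payoff affine in the total probability of action 1, so
    for [c > 0] the sender maximizes that probability. *)
Lemma sender_payoffE (v : Omega -> bool -> R) (c : R) :
  signaling_scheme mustar pi -> (forall w, v w true - v w false = c) ->
  sender_payoff v pi a =
    (\sum_w v w false * mustar w + c * \sum_w t1 pi a w)%:E.
Proof.
move=> pi_mustar vc.
pose k (i : bool * Omega) := if i.1 then c else v i.2 false.
pose A (i : bool * Omega) := [set i.2] `*` (if i.1 then M else [set: S]).
rewrite /sender_payoff (_ : (fun _ => _) = fun x => \sum_i k i * \1_(A i) x).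
  rewrite expectation_simple => [|[[] w]]; last 2 first.
    exact: measurable_slice.
    exact: measurable_slice.
  rewrite -(pair_bigA _ (fun b w => (k (b, w))%:E * pi (A (b, w)))%E) /=.
  rewrite big_bool /= addeC EFinD mulr_sumr -!sumEFin; congr (_ + _)%E.
    by apply: eq_bigr => w _; rewrite pi_mustar.
  by apply: eq_bigr => w _; rewrite EFinM t1E.
apply/funext => -[w s].
rewrite -(pair_bigA _ (fun b w' => k (b, w') * \1_(A (b, w')) (w, s))) /=.
rewrite big_bool /= /A /k /= (bigD1 w) //= [X in _ + X](bigD1 w) //=.
rewrite big1 => [|w' w'w]; last first.
  by rewrite indicE memNset ?mulr0 // => -[/= ww' _]; rewrite ww' eqxx in w'w.
rewrite big1 => [|w' w'w]; last first.
  by rewrite indicE memNset ?mulr0 // => -[/= ww' _]; rewrite ww' eqxx in w'w.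
rewrite !indicE [_ \in _ `*` [set: S]]mem_set // mulr1 !addr0.
have := vc w; case as_ : (a s).
  by rewrite mem_set // mulr1 => <-; rewrite subrK.
by rewrite memNset ?mulr0 ?add0r // => -[_]; rewrite /M /= as_.
Qed.

(** [t1] is the integral of the posterior over the signals that induce action 1, and a linear
    functional commutes with this integral. *)
Lemma dot_t1_ge0 (post : S -> Omega -> R) (f : Omega -> R) :
  is_posterior pi post -> (forall s, a s -> 0 <= dot f (post s)) ->
  0 <= dot f (t1 pi a).
Proof.
move=> [Dpost mpost postE] f0; rewrite -lee_fin.
have post01 s w : 0 <= post s w <= 1.
  have [p0 p1] := Dpost s; rewrite p0 -p1 (bigD1 w) //= lerDl.
  exact: sumr_ge0.
have mD : measurable ([set: Omega] `*` M) by exact: measurableX.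
have ipost w : pi.-integrable ([set: Omega] `*` M) (fun x => (post x.2 w)%:E).
  apply: (@measurable_bounded_integrable _ _ _ pi (fun x => post x.2 w)) => //.
  - by rewrite ltey_eq fin_num_measure.
  - apply: measurable_funTS.
    exact: (measurableT_comp (mpost w) measurable_snd).
  - exists 1; split; rewrite ?num_real // => r r1 x _ /=.
    have /andP[p0 p1] := post01 x.2 w.
    by rewrite ger0_norm // (le_trans p1) // ltW.
rewrite /dot -sumEFin.
under eq_bigr do rewrite EFinM t1E postE // -integralZl //.
rewrite -integral_sum // => [|w]; last exact: integrableZl.
apply: integral_ge0 => x [_ /= Mx].
under eq_bigr do rewrite -EFinM.
by rewrite sumEFin lee_fin; exact: f0.
Qed.

End receiver.

(** A finite signal space admits finitely many strategies, so among the optimal ones some strategy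
    is best for the sender. *)
Lemma sender_preferred_ge (rho : (Omega -> R) -> bool -> R) v
    d (S : finMeasurableType d) (pi : probability (Omega * S)%type R)
    (a : S -> bool) :
  optimal_strategy rho pi a ->
  exists2 a', sender_preferred_strategy rho v pi a' &
    (sender_payoff v pi a <= sender_payoff v pi a')%E.
Proof.
move=> opt_a.
pose opt (b : {ffun S -> bool}) := `[< optimal_strategy rho pi b >].
have finfunE (b : S -> bool) : finfun b = b :> (S -> bool).
  by apply/funext => s; rewrite ffunE.
have opt_fa : opt (finfun a) by apply/asboolP; rewrite finfunE.
pose b := [arg max_(b > finfun a | opt b) sender_payoff v pi b]%O.
have [optb maxb] : opt b /\
    forall b', opt b' -> (sender_payoff v pi b' <= sender_payoff v pi b)%E.
  by rewrite /b; case: arg_maxP.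
exists b; last by have := maxb _ opt_fa; rewrite finfunE.
split=> [|a' opt_a']; first exact/asboolP.
by rewrite -(finfunE a'); apply: maxb; apply/asboolP; rewrite finfunE.
Qed.

(** Posteriors that average to the prior define a competing scheme, whose probability of action 1
    cannot exceed that of [pi]. *)
Lemma optimal_scheme_ge (rho : (Omega -> R) -> bool -> R) v (c : R)
    d (S : measurableType d) (pi : probability (Omega * S)%type R) a
    d' (S' : finMeasurableType d') (q : S' -> R) (post : S' -> Omega -> R)
    (A : {pred S'}) :
  0 < c -> (forall w, v w true - v w false = c) ->
  optimal_scheme mustar rho v pi a ->
  (forall B : set S', measurable B) ->
  (forall s, 0 <= q s) -> (forall s, Delta (post s)) ->
  Delta mustar -> (forall w, \sum_s q s * post s w = mustar w) ->
  (forall s, s \in A -> P1 rho (post s)) ->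
  \sum_(s in A) q s <= \sum_w t1 pi a w.
Proof.
move=> c0 vc [scheme_pi [[ma _] _] max_pi] discrete_S' q0 Dpost [_ mu1] q_mu PA.
pose p (x : Omega * S') := q x.2 * post x.2 x.1.
have p0 x : 0 <= p x by rewrite mulr_ge0 //; case: (Dpost x.2).
have sump (F : Omega * S' -> R) : \sum_x F x = \sum_w \sum_s F (w, s).
  by rewrite pair_bigA; apply: eq_bigr => -[].
have p1 : \sum_x p x = 1.
  by rewrite sump -mu1; apply: eq_bigr => w _; exact: q_mu.
have discrete_prod : forall B : set (Omega * S')%type, measurable B.
  by apply: prod_discrete => //; exact/countableP.
have [pi' [pi'E int_pi']] := finite_mixture R _ (Omega * S')%type _ p id p0 p1.
have pi'X w (B : set S') : pi' ([set w] `*` B) =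
    (\sum_s q s * post s w * (s \in B)%:R)%:E.
  rewrite pi'E sump (bigD1 w) //= [X in _ + X]big1 => [|w' w'w].
    rewrite addr0; congr EFin; apply: eq_bigr => s _.
    rewrite /p /=; congr (_ * _%:R).
    by congr nat_of_bool; apply/idP/idP; rewrite !inE /= => // -[].
  apply: big1 => s _; rewrite memNset ?mulr0 // => -[/= ww' _].
  by rewrite ww' eqxx in w'w.
have mS' d0 (T : measurableType d0) (f : S' -> T) : measurable_fun [set: S'] f.
  by move=> _ B _; exact: discrete_S'.
have scheme_pi' : signaling_scheme mustar pi'.
  move=> w; rewrite pi'X -q_mu; congr EFin.
  by apply: eq_bigr => s _; rewrite in_setT mulr1.
have post_pi' : is_posterior pi' post.
  split=> [//|w|w B _]; first exact: mS'.
  rewrite pi'X int_pi' //; last first.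
    by move=> x _; rewrite lee_fin; case: (Dpost x.2).
  under [RHS]eq_bigr do rewrite -EFinM.
  rewrite sumEFin sump exchange_big /=; congr EFin; apply: eq_bigr => s _.
  rewrite /p /=; have [sB|sB] := boolP (s \in B).
    transitivity (\sum_w' q s * post s w' * post s w); last first.
      apply: eq_bigr => w' _; rewrite mem_set ?mulr1 //.
      by split=> //=; exact: set_mem.
    by rewrite -mulr_suml -mulr_sumr; case: (Dpost s) => _ ->; rewrite !mulr1.
  rewrite mulr0 big1 // => w' _; rewrite memNset; first by rewrite mulr0 mul0r.
  move=> -[_ /=].
  by move/mem_set; exact/negP.
(* Ties are broken in favour of action 1, so every signal in [A] induces it. *)
pose a0 s := `[< P1 rho (post s) >].
have opt_a0 : optimal_strategy rho pi' a0.
  split=> //; exists post => // s b; rewrite /a0; case: asboolP => [[_]|nP].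
    by rewrite /rhohat subr_ge0; case: b.
  suff : rhohat rho (post s) < 0.
    by rewrite /rhohat subr_lt0; case: b => // /ltW.
  by rewrite ltNge; apply/negP => ?; exact: nP.
(* Optimality of [pi] is stated against sender-preferred strategies, so [a0] is first replaced by
   one at least as good. *)
have [a' pref_a' ge_a'] := sender_preferred_ge rho v _ _ _ _ opt_a0.
have := le_trans ge_a' (max_pi _ _ _ _ scheme_pi' pref_a').
rewrite (sender_payoffE _ _ _ _ (mS' _ _ a0) _ _ scheme_pi' vc).
rewrite (sender_payoffE _ _ _ _ ma _ _ scheme_pi vc).
rewrite lee_fin lerD2l ler_pM2l //; apply: le_trans.
have -> : \sum_w t1 pi' a0 w = \sum_s q s * (a0 s)%:R.
  transitivity (\sum_w \sum_s q s * post s w * (a0 s)%:R).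
    apply: eq_bigr => w _; rewrite /t1.
    rewrite (_ : [set x | _] = [set w] `*` [set s | a0 s]).
      rewrite pi'X /=; apply: eq_bigr => s _.
      by congr (_ * (nat_of_bool _)%:R); exact: asboolb.
    by [].
  rewrite exchange_big /=; apply: eq_bigr => s _.
  by rewrite -mulr_suml -mulr_sumr; case: (Dpost s) => _ ->; rewrite mulr1.
rewrite big_mkcond; apply: ler_sum => s _; case: ifPn => sA.
  by rewrite /a0 asboolT ?mulr1 //; exact: PA.
by rewrite mulr_ge0.
Qed.

End schemes.

(** * Extremal elements of a strict total order *)

Lemma strict_total_order_min (T : finType) (prec : rel T) (P : pred T) (x : T) :
  strict_total_order prec -> P x ->
  exists2 m, P m & forall y, P y -> y != m -> prec m y.
Proof.
case=> irr tr tot Px.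
(* An element with fewest predecessors in [P] is minimal: by transitivity and irreflexivity,
   anything in [P] preceding it would have strictly fewer. *)
pose below m := [pred u | P u && prec u m].
have [m Pm minm] :
    exists2 m, P m & forall y, P y -> (#|below m| <= #|below y|)%N.
  by case: (@arg_minnP _ x P (fun m => #|below m|) Px) => m; exists m.
exists m => // y Py ym; have /orP[ym'|//] := tot _ _ ym.
have := minm y Py; rewrite leqNgt => /negP[]; apply: proper_card.
apply/properP; split.
  by apply/fintype.subsetP => u; rewrite !inE => /andP[-> /tr]; apply.
by exists y; rewrite !inE Py //= irr.
Qed.

Lemma strict_total_order_converse (T : finType) (prec : rel T) :
  strict_total_order prec -> strict_total_order (fun x y => prec y x).
Proof.
case=> irr tr tot; split=> [|y x z xy yz|x y xy]; first exact: irr.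
  exact: tr yz xy.
by rewrite orbC tot.
Qed.

(** * The optimal [t1] as a linear program over edge points *)

Section optimum.
Context {R : realType} {dO : measure_display} {Omega : finMeasurableType dO}.
Hypothesis discrete_Omega : forall A : set Omega, measurable A.
Context {mustar : Omega -> R} {rho : (Omega -> R) -> bool -> R}.
Context {v : Omega -> bool -> R} {c : R}.
Hypothesis Delta_mustar : Delta mustar.
Hypothesis closed_P1 : closed (P1 rho : set {ptws Omega -> R}).
Hypothesis convex_P1c :
  convex_set (P1c rho : set (convex_lmodType (Omega -> R))).
Hypothesis c0 : 0 < c.
Hypothesis vc : forall w, v w true - v w false = c.
Context {d} {S : measurableType d} (pi : probability (Omega * S)%type R).
Variable a : S -> bool.
Hypothesis opt : optimal_scheme mustar rho v pi a.

Local Notation t := (t1 pi a).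
Local Notation e := (fun p : Omega * Omega => edge_point rho p.1 p.2).
Local Notation K := (fun p : Omega * Omega => `[< K1 rho p.2 >]).

Let ma : measurable_fun [set: S] a.
Proof. by case: opt => _ [[]]. Qed.

Let pi_mustar : signaling_scheme mustar pi.
Proof. by case: opt. Qed.

Let mM : measurable (a @^-1` [set true]).
Proof. by have := ma measurableT [set true]; rewrite setTI; apply. Qed.

Lemma t1_le w : t w <= mustar w.
Proof.
rewrite -lee_fin (t1E discrete_Omega) // -pi_mustar.
apply: le_measure; rewrite ?inE; do ?exact: measurableX.
by move=> x [xw _]; split.
Qed.

Lemma t1_cone : exists2 y : Omega * Omega -> R, forall p, 0 <= y p &
  forall w, t w = \sum_(p | K p) y p * e p w.
Proof.
have [[y y0 ty]|[f f0 ft]] := farkas _ (enum K) e t (enum_uniq K).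
  by exists y => // w; rewrite ty big_enum.
case: opt => _ [[_ [post post_pi best]] _] _.
suff : 0 <= dot f t by rewrite leNgt ft.
apply: (dot_t1_ge0 discrete_Omega _ _ _ _ ma post) => // s as_.
apply: (P1_dot_ge0 rho convex_P1c) => [w0 w1 Kw1|].
  by apply: (f0 (w0, w1)); rewrite mem_enum; exact/asboolP.
split; first by case: post_pi.
by rewrite /rhohat subr_ge0; have := best s false; rewrite as_.
Qed.

(* The scheme sends the signal [(w0, w1)] with posterior [edge_point w0 w1] when
   [w1] is in [K1], and reveals each remaining state [w] by the signal [(w, l)],
   which is unused so far because [l] is not in [K1]. *)
Lemma cone_le (l : Omega) (y : Omega * Omega -> R) : ~ K1 rho l ->
  (forall p, 0 <= y p) -> (forall w, \sum_(p | K p) y p * e p w <= mustar w) ->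
  \sum_(p | K p) y p <= \sum_w t w.
Proof.
move=> Kl y0 y_le.
pose r w := mustar w - \sum_(p | K p) y p * e p w.
pose q p := if K p then y p else if p.2 == l then r p.1 else 0.
pose post p := if K p then e p else point_mass p.1.
have -> : \sum_(p | K p) y p = \sum_(p in K) q p.
  by apply: eq_bigr => p Kp; rewrite /q Kp.
apply: (optimal_scheme_ge discrete_Omega mustar rho v c _ _ _ _ _
  (Omega * Omega)%type q post) => //.
- move=> B; apply: (prod_discrete _ _ Omega Omega) => //.
  exact/countableP.
- by move=> p; rewrite /q; do 2 case: ifP => // _; rewrite subr_ge0.
- move=> p; rewrite /post; case: asboolP => Kp; last exact: Delta_point_mass.
  exact: Delta_edge_point.
- move=> w; rewrite (bigID K) /=.
  under eq_bigr => p Kp do rewrite /q /post Kp.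
  under [X in _ + X]eq_bigr => p /negPf Kp do rewrite /q /post Kp.
  rewrite [X in _ + X](bigD1 (w, l)) /=; last exact/asboolPn.
  rewrite [X in _ + (_ + X)]big1 => [|[w' l'] /= /andP[_ neq]].
    by rewrite eqxx /point_mass eqxx mulr1 addr0 /r addrC subrK.
  have [ll'|_] := eqVneq l' l; last by rewrite mul0r.
  rewrite /point_mass; have [ww'|_] := eqVneq w w'; last by rewrite mulr0.
  by rewrite ll' ww' eqxx in neq.
- move=> p Kp; rewrite /post (_ : K p = true) //.
  by apply: P1_edge_point => //; exact/asboolP.
Qed.

Section exchange.
Variables (l : Omega) (y : Omega * Omega -> R).
Hypotheses (Kl : ~ K1 rho l) (y0 : forall p, 0 <= y p).
Hypothesis ty : forall w, t w = \sum_(p | K p) y p * e p w.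

Let sum_delta (F : Omega * Omega -> R) p0 :
  K p0 -> \sum_(p | K p) (p == p0)%:R * F p = F p0.
Proof.
move=> Kp0; rewrite (bigD1 p0) //= eqxx mul1r big1 ?addr0 // => p /andP[_].
by move=> /negPf ->; rewrite mul0r.
Qed.

(** Edge points have total mass one, so the mass of [t] is the sum of the [y p]; optimality then
    forbids a feasible change of weights with positive sum. *)
Lemma cone_variation_le0 (z : Omega * Omega -> R) :
  (forall p, 0 <= y p + z p) ->
  (forall w, t w + \sum_(p | K p) z p * e p w <= mustar w) ->
  \sum_(p | K p) z p <= 0.
Proof.
move=> yz0 z_le.
have := cone_le l (fun p => y p + z p) Kl yz0.
have -> : \sum_w t w = \sum_(p | K p) y p.
  under eq_bigr do rewrite ty.
  rewrite exchange_big /=; apply: eq_bigr => p /asboolP Kp.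
  rewrite -mulr_sumr; case: (Delta_edge_point rho p.1 p.2 Kp) => _ ->.
  by rewrite mulr1.
rewrite big_split /= gerDl; apply => w.
under eq_bigr do rewrite mulrDl.
by rewrite big_split /= -ty.
Qed.

(** The degenerate edge [(w, w)] has the point mass at [w] as its edge point. Adding the slack
    [mustar w - t w] to its weight is feasible, so the slack cannot be positive. *)
Lemma t1_K1 w : K1 rho w -> t w = mustar w.
Proof.
move=> Kw; apply/eqP; rewrite eq_le t1_le /= -subr_le0.
have Kww : K (w, w) by exact/asboolP.
have /= <- := sum_delta (fun=> mustar w - t w) _ Kww.
have r0 : 0 <= mustar w - t w by rewrite subr_ge0 t1_le.
apply: cone_variation_le0 => [p|w']; first by rewrite addr_ge0 // mulr_ge0.
under eq_bigr do rewrite -mulrA.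
rewrite (sum_delta (fun p => _ * e p w')) //=.
rewrite /edge_point /mix -scalerDl addrCA subrr addr0 scale1r /point_mass.
have [->|_] := eqVneq w' w; first by rewrite mulr1 addrCA subrr addr0.
by rewrite mulr0 addr0 t1_le.
Qed.

(* Move the [w1]-mass that is mixed with [w'] to the edge from [w] to [w1]:
   since [gamma w w1] is larger, the same mass of [w1] supports more of [w]
   than it did of [w']. *)
Lemma t1_exchange w w' :
  (forall w1, K1 rho w1 -> gamma rho w' w1 < gamma rho w w1) ->
  ~ K1 rho w' -> t w < mustar w -> t w' = 0.
Proof.
move=> lt_gamma Kw' tw; apply/eqP; rewrite ty; apply/negPn/negP.
rewrite psumr_neq0 => [|p /asboolP Kp]; last first.
  by rewrite mulr_ge0 //; case: (Delta_edge_point rho p.1 p.2 Kp).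
case/hasP => -[w'' w1] _ /andP[Kp]; have Kw1 : K1 rho w1 by exact/asboolP.
(* An edge contributing at [w'] ends in [K1], hence not at [w'], so [w'] must be its first
   endpoint. *)
have w'w1 : (w' == w1) = false.
  by apply/negP => /eqP ww1; apply: Kw'; rewrite ww1.
have [<-{w'' Kp}|w'w''] := eqVneq w' w''; last first.
  rewrite /edge_point /mix !fctE /= /point_mass w'w1 (negPf w'w'').
  by rewrite /GRing.scale /= !mulr0 addr0 mulr0 ltxx.
have /andP[g0 g1] := gamma_itv rho w w1 Kw1.
have /andP[g'0 g'1] := gamma_itv rho w' w1 Kw1.
have := lt_gamma w1 Kw1.
set g := gamma rho w w1 in g0 g1 *; set g' := gamma rho w' w1 in g'0 g'1 *.
move=> g'g y_pos.
have yp : 0 < y (w', w1).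
  rewrite lt_neqAle y0 andbT; apply: contraTneq y_pos => <-.
  by rewrite mul0r ltxx.
pose eps := Num.min (y (w', w1)) (mustar w - t w).
have eps0 : 0 < eps by rewrite lt_min yp subr_gt0.
have eps_y : eps <= y (w', w1) by rewrite ge_min lexx.
have eps_mu : eps <= mustar w - t w by rewrite ge_min lexx orbT.
(* Both changes involve the same mass [eps * (1 - g) * (1 - g')] of [w1], which cancels, while the
   total weight grows by [eps * (g - g')]. *)
pose z p := (p == (w, w1))%:R * (eps * (1 - g')) +
  (p == (w', w1))%:R * (- eps * (1 - g)).
have Kp : K (w, w1) by exact/asboolP.
have Kp' : K (w', w1) by exact/asboolP.
have : \sum_(p | K p) z p <= 0.
  apply: cone_variation_le0 => [p|u].
    have eps_g' : 0 <= eps * (1 - g') by rewrite mulr_ge0 ?subr_ge0 // ltW.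
    rewrite /z addrCA addr_ge0 //; first by rewrite mulr_ge0.
    have [->|_] := eqVneq p (w', w1); last by rewrite mul0r addr0.
    rewrite mul1r mulNr subr_ge0 (le_trans _ eps_y) //.
    by rewrite ler_piMr ?(ltW eps0) // gerBl.
  have -> : \sum_(p | K p) z p * e p u =
      eps * ((1 - g') * g * (u == w)%:R - (1 - g) * g' * (u == w')%:R).
    under eq_bigr do rewrite /z mulrDl -!mulrA.
    rewrite big_split /= !sum_delta //=.
    rewrite /edge_point /mix !fctE /= /point_mass /GRing.scale /= -/g -/g'.
    ring.
  apply: (@le_trans _ _ (t u + eps * (u == w)%:R)).
    rewrite lerD2l ler_wpM2l ?(ltW eps0) //.
    apply: (@le_trans _ _ ((1 - g') * g * (u == w)%:R)).
      by rewrite gerBl !mulr_ge0 ?subr_ge0.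
    by rewrite ler_piMl // mulr_ile1 ?subr_ge0 // gerBl.
  have [->|_] := eqVneq u w; first by rewrite mulr1 -lerBrDl.
  by rewrite mulr0 addr0 t1_le.
rewrite big_split /= !sum_delta // leNgt.
have -> : eps * (1 - g') + - eps * (1 - g) = eps * (g - g') by ring.
by rewrite mulr_gt0 // subr_gt0.
Qed.

End exchange.

Lemma ae_false_t1 w : t w = 0 -> {ae pi, forall x, x.1 = w -> a x.2 = false}.
Proof.
move=> tw; exists ([set w] `*` (a @^-1` [set true])); split.
- exact: measurable_slice.
- by rewrite -(t1E discrete_Omega) // tw.
- by move=> x /= /not_implyP[xw ax]; split=> //=; case: (a x.2) ax.
Qed.

Lemma ae_true_t1 w :
  t w = mustar w -> {ae pi, forall x, x.1 = w -> a x.2 = true}.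
Proof.
move=> tw.
have mMc : measurable (a @^-1` [set false]).
  by have := ma measurableT [set false]; rewrite setTI; apply.
exists ([set w] `*` (a @^-1` [set false])); split.
- exact: measurable_slice.
(* The action-1 part of the slice already carries the whole prior mass of [w], which leaves the
   action-0 part null. *)
- have : pi ([set w] `*` [set: S]) =
      (pi ([set w] `*` a @^-1` [set true]) +
       pi ([set w] `*` a @^-1` [set false]))%E.
    rewrite -measureU; do ?exact: measurable_slice.
      congr (pi _); apply/seteqP; split=> [[w' s] [/= -> _]|x [] [xw _]] //.
      by case as_: (a s); [left|right].
    by apply/seteqP; split=> // x [[_ /= ->] [_ /=]].
  rewrite pi_mustar -(t1E discrete_Omega) // tw.
  have fB : pi ([set w] `*` a @^-1` [set false]) \is a fin_num.
    by apply: fin_num_measure; exact: measurable_slice.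
  rewrite -(fineK fB) -EFinD => -[/esym/eqP].
  by rewrite -subr_eq0 addrC addKr => /eqP ->.
- by move=> x /= /not_implyP[xw ax]; split=> //=; case: (a x.2) ax.
Qed.

End optimum.

(** * Choice of the threshold state *)

Theorem proposition3 (R : realType)
  (dO : measure_display) (Omega : finMeasurableType dO)
  (hOmega : forall A : set Omega, measurable A)
  (mustar : Omega -> R) (hmustar : Delta mustar)
  (rho : (Omega -> R) -> bool -> R) (v : Omega -> bool -> R)
  (hP0 : closed (P0 rho : set {ptws Omega -> R}))
  (hP1 : closed (P1 rho : set {ptws Omega -> R}))
  (c : R) (hc : 0 < c) (hv : forall w : Omega, v w true - v w false = c)
  (hconv : convex_set (P1c rho : set (convex_lmodType (Omega -> R))))
  (prec : rel Omega) (hprec : strict_total_order prec)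
  (hmono : monotone_order rho prec)
  (hL0 : L0 rho !=set0)
  (d : measure_display) (S : measurableType d)
  (pi : probability (Omega * S)%type R) (a : S -> bool)
  (hopt : optimal_scheme mustar rho v pi a) :
  exists2 w0 : Omega, L0 rho w0 &
    [/\ forall w : Omega, prec w w0 -> t1 pi a w = mustar w,
        forall w : Omega, prec w0 w -> t1 pi a w = 0 &
        {ae pi, forall x : Omega * S,
          (prec x.1 w0 -> a x.2 = true) /\ (prec w0 x.1 -> a x.2 = false)}].
Proof.
case: hL0 => l Ll; have Kl := Ll.2.
have L0E w : ~ K1 rho w -> L0 rho w.
  move=> Kw; split=> //; split; first exact: Delta_point_mass.
  rewrite leNgt; apply/negP => /ltW rw; apply: Kw; split=> //.
  exact: Delta_point_mass.
have [y y0 ty] := t1_cone hOmega hconv pi a hopt.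
have t1_full := t1_K1 hOmega hmustar hP1 hc hv pi a hopt l y Kl y0 ty.
have exchange := t1_exchange hOmega hmustar hP1 hc hv pi a hopt l y Kl y0 ty.
have t_le := t1_le hOmega pi a hopt.
suff [w0 Lw0 [below above]] : exists2 w0, L0 rho w0 &
    (forall w, L0 rho w -> prec w w0 -> t1 pi a w = mustar w) /\
    (forall w, prec w0 w -> t1 pi a w = 0).
  have {}below w : prec w w0 -> t1 pi a w = mustar w.
    have [Kw _|/L0E] := pselect (K1 rho w); [exact: t1_full|exact: below].
  exists w0 => //; split=> //.
  (* There is one null set for each state, and finitely many of them are united. *)
  have ae_above :
      {ae pi, forall x (w : Omega), prec w0 w -> x.1 = w -> a x.2 = false}.
    apply: filter_forall => w; have [w0w|] := boolP (prec w0 w).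
      have := ae_false_t1 hOmega pi a hopt w (above w w0w).
      by apply: filterS => x ax _.
    by move=> _; exact: aeW.
  have ae_below :
      {ae pi, forall x (w : Omega), prec w w0 -> x.1 = w -> a x.2 = true}.
    apply: filter_forall => w; have [ww0|] := boolP (prec w w0).
      have := ae_true_t1 hOmega pi a hopt w (below w ww0).
      by apply: filterS => x ax _.
    by move=> _; exact: aeW.
  apply: filterS2 ae_above ae_below => x Fx Tx.
  by split=> h; [exact: Tx h _|exact: Fx h _].
pose gap w := `[< L0 rho w >] && (t1 pi a w < mustar w).
have [[w gap_w]|gap0] := pselect (exists w, gap w).
  have [w0 /andP[/asboolP Lw0 gap_w0] min_w0] :=
    strict_total_order_min _ _ gap _ hprec gap_w.
  exists w0 => //; split=> [u Lu uw0|u w0u].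
    apply/eqP; rewrite eq_le t_le leNgt; apply/negP => tu.
    case: hprec => irr tr _.
    have [uw|uw] := eqVneq u w0; first by rewrite uw irr in uw0.
    have := min_w0 u; rewrite /gap tu asboolT // => /(_ isT uw) /tr /(_ uw0).
    by rewrite irr.
  case: (hmono _ _ w0u) => [/Lw0.2//|[_ [_ Ku] lt_gamma]].
  exact: exchange Ku gap_w0.
(* If all of [L0] is exhausted, its last state serves: by monotonicity any state after it would
   again lie in [L0]. *)
have [w0 /asboolP Lw0 max_w0] :=
  strict_total_order_min _ _ (fun w => `[< L0 rho w >]) l
  (strict_total_order_converse _ _ hprec) (asboolT Ll).
exists w0 => //; split=> [u Lu _|u w0u].
  apply/eqP; rewrite eq_le t_le leNgt; apply/negP => tu.
  by apply: gap0; exists u; rewrite /gap asboolT.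
case: hprec => irr tr _.
case: (hmono _ _ w0u) => [/Lw0.2//|[_ Lu _]].
have [uw|uw] := eqVneq u w0; first by rewrite uw irr in w0u.
by have := tr _ _ _ (max_w0 u (asboolT Lu) uw) w0u; rewrite irr.
Qed.
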